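(* Let $M$ be a differentiable manifold, let $m\geq 1$ be an integer, and let $\boldsymbol{A},\boldsymbol{B}:\mathfrak{X}(M)\to\mathfrak{X}(M)$ be two generalized Nijenhuis operators of level $m$, i.e. $(1,1)$-tensor fields with $\tau^{(m)}_{\boldsymbol{A}}=\tau^{(m)}_{\boldsymbol{B}}=0$. Consider the $2m-1$ conditions $$ (\ast)\qquad \mathcal{P}^{(m)}(\underbrace{\boldsymbol{A},\ldots,\boldsymbol{A}}_{(2m-k)\text{ times}},\underbrace{\boldsymbol{B},\ldots,\boldsymbol{B}}_{k\text{ times}})(X,Y)=\boldsymbol{0}\quad\text{for all }X,Y\in\mathfrak{X}(M),\qquad k=1,\ldots,2m-1 . $$ (1) For every $m\geq 1$, $\boldsymbol{A}$ and $\boldsymbol{B}$ generate a generalized Haantjes vector space of level $m$ if and only if the conditions $(\ast)$ are satisfied. (2) If $m\geq 2$ and $\boldsymbol{A}$ and $\boldsymbol{B}$ commute ($\boldsymbol{A}\boldsymbol{B}=\boldsymbol{B}\boldsymbol{A}$), then $\boldsymbol{A}$ and $\boldsymbol{B}$ generate a generalized Haantjes $C^\infty(M)$-module of level $m$ if and only if the same conditions $(\ast)$ are satisfied.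
   Context: All tensor fields are smooth. $\mathfrak{X}(M)$ is the Lie algebra of smooth vector fields on $M$, with Lie bracket $[\cdot,\cdot]$. An operator is a smooth $(1,1)$-tensor field on $M$, viewed as a $C^\infty(M)$-linear map $\mathfrak{X}(M)\to\mathfrak{X}(M)$; $\mathcal{T}^1_1(M)$ is the space of operators. Generalized Nijenhuis torsions: for an operator $\boldsymbol{A}$ put $\tau^{(0)}_{\boldsymbol{A}}(X,Y):=[X,Y]$ and, for $m\geq 1$, $$\tau^{(m)}_{\boldsymbol{A}}(X,Y):=\boldsymbol{A}^2\tau^{(m-1)}_{\boldsymbol{A}}(X,Y)+\tau^{(m-1)}_{\boldsymbol{A}}(\boldsymbol{A}X,\boldsymbol{A}Y)-\boldsymbol{A}\big(\tau^{(m-1)}_{\boldsymbol{A}}(X,\boldsymbol{A}Y)+\tau^{(m-1)}_{\boldsymbol{A}}(\boldsymbol{A}X,Y)\big),\quad X,Y\in\mathfrak{X}(M).$$ Polarization: for $m\geq 1$ and operators $\boldsymbol{A}_1,\ldots,\boldsymbol{A}_{2m}$, $$\mathcal{P}^{(m)}(\boldsymbol{A}_1,\ldots,\boldsymbol{A}_{2m})(X,Y):=\sum_{\emptyset\neq\mathcal{I}\subseteq\{1,\ldots,2m\}}(-1)^{2m-|\mathcal{I}|}\,\tau^{(m)}_{\sum_{i\in\mathcal{I}}\boldsymbol{A}_i}(X,Y).$$ A generalized Haantjes module of level $m$ on $M$ is a set $\mathscr{H}$ of operators such that $\tau^{(m)}_{f\boldsymbol{K}_1+g\boldsymbol{K}_2}(X,Y)=\boldsymbol{0}$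 for all $X,Y\in\mathfrak{X}(M)$, all $f,g\in C^\infty(M)$ and all $\boldsymbol{K}_1,\boldsymbol{K}_2\in\mathscr{H}$; it is called a generalized Haantjes vector space of level $m$ if this property is required only for real constants $f,g$. That $\boldsymbol{A},\boldsymbol{B}$ generate a generalized Haantjes vector space (respectively module) of level $m$ means that the set of all combinations $\lambda\boldsymbol{A}+\mu\boldsymbol{B}$ with $\lambda,\mu\in\mathbb{R}$ (respectively $\lambda,\mu\in C^\infty(M)$) is such, i.e. $\tau^{(m)}_{\lambda\boldsymbol{A}+\mu\boldsymbol{B}}=0$ for all $\lambda,\mu\in\mathbb{R}$ (respectively all $\lambda,\mu\in C^\infty(M)$). *)

(* Defs.v *)
From HB Require Import structures.
From mathcomp Require Import all_boot all_order all_algebra.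
From mathcomp Require Import all_classical all_reals all_analysis.
From mathcomp Require Import ring.

Set Implicit Arguments.
Unset Strict Implicit.
Unset Printing Implicit Defensive.

Import Order.TTheory GRing.Theory Num.Theory.
Import numFieldNormedType.Exports.

Local Open Scope classical_set_scope.
Local Open Scope ring_scope.

Section SmoothEuclidean.
Context {R : realType} {n : nat}.
Implicit Types (U : set 'rV[R]_n) (f g : 'rV[R]_n -> R).

(* [Ck k U f]: all partial derivatives of [f] of order at most [k] exist and
   are continuous at every point of [U] (only used for open [U]). *)
Fixpoint Ck (k : nat) U f : Prop :=
  (forall x, U x -> {for x, continuous f}) /\
  (if k is k'.+1 then
     forall i : 'I_n,
       (forall x, U x -> derivable f x (delta_mx 0 i)) /\
       Ck k' U (fun x => 'D_(delta_mx 0 i) f x)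
   else True).

Definition smooth_on U f := forall k, Ck k U f.

Lemma Ck_continuous k U f : Ck k U f -> forall x, U x -> {for x, continuous f}.
Proof. by case: k => [|k] []. Qed.

Lemma Ck_le k U f : Ck k.+1 U f -> Ck k U f.
Proof.
elim: k f => [|k IH] f; first by move=> [].
move=> [cf df]; split=> // i; have [dfi Ci] := df i.
by split=> //; apply: IH.
Qed.

Lemma near_eq_continuous_at f g x :
  (\near x, f x = g x) -> {for x, continuous f} -> {for x, continuous g}.
Proof.
move=> fg; rewrite /prop_for /continuous_at -(nbhs_singleton fg) => cf.
by move=> P /cf; exact: (near_eq_cvg fg).
Qed.

Lemma Ck_ext k U f g : open U -> (forall x, U x -> f x = g x) ->
  Ck k U f -> Ck k U g.
Proof.
move=> oU; elim: k f g => [|k IH] f g fg [cf df].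
all: have nfg x : U x -> \near x, f x = g x
  by move=> Ux; apply: filterS (open_nbhs_nbhs (conj oU Ux)) => y /fg.
all: split=> [x Ux|]; first exact: near_eq_continuous_at (nfg x Ux) (cf x Ux).
  by [].
move=> i; have [dfi Ci] := df i; split.
  by move=> x Ux; apply: near_eq_derivable (dfi _ Ux); exact: nfg.
by apply: IH Ci => x Ux; apply: near_eq_derive; exact: nfg.
Qed.

Lemma Ck_cst k U (r : R) : Ck k U (cst r).
Proof.
elim: k r => [|k IH] r; first by split=> // x _; exact: cst_continuous.
split=> [x _|i]; first exact: cst_continuous.
split=> [x _|]; first exact: derivable_cst.
rewrite [X in Ck _ _ X](_ : _ = cst 0); first exact: IH.
by apply/funext=> x; rewrite derive_cst.
Qed.

Lemma Ck_add k U f g : open U -> Ck k U f -> Ck k U g -> Ck k U (f \+ g).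
Proof.
move=> oU; elim: k f g => [|k IH] f g [cf df] [cg dg].
  by split=> // x Ux; apply: continuousD; [exact: cf|exact: cg].
split=> [x Ux|i]; first by apply: continuousD; [exact: cf|exact: cg].
have [dfi Cfi] := df i; have [dgi Cgi] := dg i; split=> [x Ux|].
  by apply: derivableD; [exact: dfi|exact: dgi].
apply: Ck_ext (IH _ _ Cfi Cgi) => // x Ux /=.
by rewrite -(deriveD (dfi _ Ux) (dgi _ Ux)).
Qed.

Lemma Ck_mul k U f g : open U -> Ck k U f -> Ck k U g -> Ck k U (f \* g).
Proof.
move=> oU; elim: k f g => [|k IH] f g Cf Cg.
  case: Cf Cg => [cf _] [cg _].
  by split=> // x Ux; apply: continuousM; [exact: cf|exact: cg].
have [cf df] := Cf; have [cg dg] := Cg.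
split=> [x Ux|i]; first by apply: continuousM; [exact: cf|exact: cg].
have [dfi Cfi] := df i; have [dgi Cgi] := dg i; split=> [x Ux|].
  by apply: derivableM; [exact: dfi|exact: dgi].
apply: Ck_ext (Ck_add oU (IH _ _ (Ck_le Cf) Cgi) (IH _ _ (Ck_le Cg) Cfi)) => //.
by move=> x Ux /=; rewrite (deriveM (dfi _ Ux) (dgi _ Ux)).
Qed.

End SmoothEuclidean.

(* A chart is a homeomorphism from an open subset [chart_dom] of [M] onto an
   open subset of R^n; the values of [chart_map] outside [chart_dom] and of
   [chart_inv] outside the image are irrelevant. *)
Record chart (R : realType) (n : nat) (M : topologicalType) := Chart {
  chart_dom : set M;
  chart_map : M -> 'rV[R]_n;
  chart_inv : 'rV[R]_n -> M;
  chart_dom_open : open chart_dom;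
  chart_img_open : open (chart_map @` chart_dom);
  chart_mapK : forall p, chart_dom p -> chart_inv (chart_map p) = p;
  chart_map_continuous :
    forall p, chart_dom p -> {for p, continuous chart_map};
  chart_inv_continuous :
    forall x, (chart_map @` chart_dom) x -> {for x, continuous chart_inv} }.

(* Smooth manifolds of dimension [n], presented by a (not necessarily maximal)
   smooth atlas. *)
Record smooth_manifold (R : realType) (n : nat) := SmoothManifold {
  carrier :> topologicalType;
  manifold_hausdorff : hausdorff_space carrier;
  manifold_second_countable : @second_countable carrier;
  atlas : set (chart R n carrier);
  atlas_cover : forall p : carrier, exists2 c, atlas c & chart_dom c p;
  atlas_compatible : forall c d, atlas c -> atlas d -> forall i : 'I_n,
    smooth_on (chart_map c @` (chart_dom c `&` chart_dom d))
              (fun x => chart_map d (chart_inv c x) 0 i) }.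

Section SmoothFunctions.
Context {R : realType} {n : nat} (M : smooth_manifold R n).

Definition is_smooth : {pred (M -> R)} := fun f =>
  `[< forall c, atlas c ->
        smooth_on (chart_map c @` chart_dom c) (f \o chart_inv c) >].

Record smooth_fun := SmoothFun {
  smooth_fun_val :> M -> R;
  smooth_funP : smooth_fun_val \in is_smooth }.

HB.instance Definition _ := [isSub for smooth_fun_val].
HB.instance Definition _ := [Choice of smooth_fun by <:].

Lemma cst_is_smooth (r : R) : (cst r : M -> R) \in is_smooth.
Proof. by apply/asboolP => c _ k; exact: Ck_cst. Qed.

Lemma is_smooth_subring : subring_closed is_smooth.
Proof.
have mulS f g : f \in is_smooth -> g \in is_smooth -> f * g \in is_smooth.
  move=> /asboolP sf /asboolP sg; apply/asboolP => c ac k.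
  exact: (Ck_mul (f := f \o chart_inv c) (g := g \o chart_inv c)
    (@chart_img_open _ _ _ c) (sf c ac k) (sg c ac k)).
split=> [|f g sf sg|//]; first exact: cst_is_smooth.
have -> : f - g = f + cst (-1) * g.
  by apply/funext=> p; rewrite -[RHS]/(f p + -1 * g p) mulN1r.
have /asboolP sg' := mulS _ _ (cst_is_smooth (-1)) sg.
move: sf => /asboolP sf; apply/asboolP => c ac k.
exact: (Ck_add (f := f \o chart_inv c)
  (g := (cst (-1) * g) \o chart_inv c)
  (@chart_img_open _ _ _ c) (sf c ac k) (sg' c ac k)).
Qed.

HB.instance Definition _ :=
  GRing.SubChoice_isSubComPzRing.Build (M -> R) is_smooth smooth_fun
    is_smooth_subring.

Definition smooth_cst (r : R) : smooth_fun := SmoothFun (cst_is_smooth r).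

End SmoothFunctions.

Arguments is_smooth {R n} M f.

Section VectorFields.
Context {R : realType} {n : nat} (M : smooth_manifold R n).
Local Notation Cinf := (smooth_fun M).

(* The tangent space at [p] is the space of derivations at [p] of the algebra
   of smooth functions. *)
Definition is_tangent_vector (p : M) (v : Cinf -> R) :=
  [/\ forall f g, v (f + g) = v f + v g,
      forall (r : R) f, v (smooth_cst M r * f) = r * v f &
      forall f g, v (f * g) = f p * v g + g p * v f].

(* A vector field is a section of the tangent bundle; it is smooth when it maps
   smooth functions to smooth functions. *)
Definition is_smooth_vector_field : {pred (M -> Cinf -> R)} := fun X =>
  `[< (forall p, is_tangent_vector p (X p)) /\
      (forall f, (fun p => X p f) \in is_smooth M) >].

Record vector_field := VectorField {
  vector_field_val :> M -> Cinf -> R;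
  vector_fieldP : vector_field_val \in is_smooth_vector_field }.

HB.instance Definition _ := [isSub for vector_field_val].
HB.instance Definition _ := [Choice of vector_field by <:].

Lemma vf_tangent (X : vector_field) p : is_tangent_vector p (X p).
Proof. by case: X => X /= /asboolP[]. Qed.

Lemma vf_smooth (X : vector_field) f : (fun p => X p f) \in is_smooth M.
Proof. by case: X => X /= /asboolP[]. Qed.

(* The derivative [X f] of a smooth function [f] along [X]. *)
Definition vf_apply (X : vector_field) (f : Cinf) : Cinf :=
  SmoothFun (vf_smooth X f).

Lemma vector_field_zmod_closed : zmod_closed is_smooth_vector_field.
Proof.
split=> [|X Y /asboolP[tX sX] /asboolP[tY sY]]; apply/asboolP; split.
- by move=> p; split=> *; rewrite ?mulr0 ?addr0.
- by move=> f; exact: (cst_is_smooth M 0).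
- move=> p; have [aX lX dX] := tX p; have [aY lY dY] := tY p.
  have E f : (X - Y) p f = X p f - Y p f by [].
  split=> [f g|r f|f g]; rewrite !E.
  + by rewrite aX aY opprD addrACA.
  + by rewrite lX lY mulrBr.
  + by rewrite dX dY !mulrBr opprD addrACA.
- by move=> f; have [_ H _] := is_smooth_subring M; exact: H (sX f) (sY f).
Qed.

HB.instance Definition _ :=
  GRing.SubChoice_isSubZmodule.Build (M -> Cinf -> R) is_smooth_vector_field
    vector_field vector_field_zmod_closed.

Fact scale_vf_subproof (f : Cinf) (X : vector_field) :
  (fun p g => f p * X p g) \in is_smooth_vector_field.
Proof.
apply/asboolP; split=> [p|g].
  have [aX lX dX] := vf_tangent X p; split=> [g h|r g|g h].
  - by rewrite aX mulrDr.
  - by rewrite lX mulrCA.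
  - by rewrite dX mulrDr !(mulrCA (f p)).
have [_ _ H] := is_smooth_subring M.
exact: H (smooth_funP f) (vf_smooth X g).
Qed.

Definition scale_vf f X := VectorField (scale_vf_subproof f X).

Lemma vf_eqP (X Y : vector_field) : (forall p g, X p g = Y p g) -> X = Y.
Proof. by move=> XY; apply/val_inj/funext => p; apply/funext => g; exact: XY. Qed.

Fact scale_vfA f g X : scale_vf f (scale_vf g X) = scale_vf (f * g) X.
Proof. by apply: vf_eqP => p h /=; rewrite mulrA. Qed.

Fact scale_vf1 : left_id 1 scale_vf.
Proof. by move=> X; apply: vf_eqP => p h /=; rewrite mul1r. Qed.

Fact scale_vfDr : right_distributive scale_vf +%R.
Proof. by move=> f X Y; apply: vf_eqP => p h /=; rewrite -mulrDr. Qed.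

Fact scale_vfDl X : {morph scale_vf^~ X : f g / f + g}.
Proof. by move=> f g; apply: vf_eqP => p h /=; rewrite -mulrDl. Qed.

HB.instance Definition _ :=
  GRing.Zmodule_isLmodule.Build Cinf vector_field
    scale_vfA scale_vf1 scale_vfDr scale_vfDl.

Fact lie_bracket_subproof (X Y : vector_field) :
  (fun p f => X p (vf_apply Y f) - Y p (vf_apply X f))
    \in is_smooth_vector_field.
Proof.
have addE Z f g : vf_apply Z (f + g) = vf_apply Z f + vf_apply Z g.
  by apply/val_inj/funext => p /=; have [-> _ _] := vf_tangent Z p.
have cstE Z r f :
    vf_apply Z (smooth_cst M r * f) = smooth_cst M r * vf_apply Z f.
  by apply/val_inj/funext => p /=; have [_ -> _] := vf_tangent Z p.
have mulE Z f g : vf_apply Z (f * g) = f * vf_apply Z g + g * vf_apply Z f.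
  by apply/val_inj/funext => p /=; have [_ _ ->] := vf_tangent Z p.
apply/asboolP; split=> [p|f]; last first.
  have [_ H _] := is_smooth_subring M.
  exact: H (vf_smooth X (vf_apply Y f)) (vf_smooth Y (vf_apply X f)).
have [aX lX dX] := vf_tangent X p; have [aY lY dY] := vf_tangent Y p.
split=> [f g|r f|f g].
- by rewrite !addE aX aY opprD addrACA.
- by rewrite !cstE lX lY mulrBr.
- rewrite !mulE aX aY !dX !dY /= !mulrBr [Y p f * _]mulrC [Y p g * _]mulrC.
  ring.
Qed.

Definition lie_bracket X Y : vector_field :=
  VectorField (lie_bracket_subproof X Y).

End VectorFields.

Arguments lie_bracket {R n M} X Y.

Section Operators.
Context {R : realType} {n : nat} (M : smooth_manifold R n).
Local Notation Cinf := (smooth_fun M).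
Local Notation VF := (vector_field M).

(* Smooth (1,1)-tensor fields, as C^oo(M)-linear endomorphisms of the module of
   smooth vector fields. *)
Definition operator : Type := {linear VF -> VF}.

HB.instance Definition _ := gen_eqMixin operator.
HB.instance Definition _ := gen_choiceMixin operator.

Implicit Types (A B C : operator) (f g : Cinf) (X Y : VF).

Lemma operator_eqP A B : (forall X, A X = B X) -> A = B.
Proof.
case: A B => [A [[a1] [a2]]] [B [[b1] [b2]]] /= /funext AB; case: _ / AB in b1 b2 *.
by congr (GRing.Linear.Pack (GRing.Linear.Class _ _));
  [congr GRing.isNmodMorphism.phant_Build|congr GRing.isScalable.phant_Build];
  exact: Prop_irrelevance.
Qed.

Definition zero_op : operator := \0.
Definition opp_op A : operator := \- A.
Definition add_op A B : operator := A \+ B.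
Definition scale_op f A : operator := f \*: A.

Fact add_opA : associative add_op.
Proof. by move=> A B C; apply: operator_eqP => X /=; rewrite addrA. Qed.
Fact add_opC : commutative add_op.
Proof. by move=> A B; apply: operator_eqP => X /=; rewrite addrC. Qed.
Fact add_0op : left_id zero_op add_op.
Proof. by move=> A; apply: operator_eqP => X /=; rewrite add0r. Qed.
Fact add_Nop : left_inverse zero_op opp_op add_op.
Proof. by move=> A; apply: operator_eqP => X /=; rewrite addNr. Qed.

HB.instance Definition _ :=
  GRing.isZmodule.Build operator add_opA add_opC add_0op add_Nop.

Fact scale_opA f g A : scale_op f (scale_op g A) = scale_op (f * g) A.
Proof. by apply: operator_eqP => X /=; rewrite scalerA. Qed.
Fact scale_op1 : left_id 1 scale_op.
Proof. by move=> A; apply: operator_eqP => X /=; rewrite scale1r. Qed.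
Fact scale_opDr : right_distributive scale_op +%R.
Proof. by move=> f A B; apply: operator_eqP => X /=; rewrite scalerDr. Qed.
Fact scale_opDl A : {morph scale_op^~ A : f g / f + g}.
Proof. by move=> f g; apply: operator_eqP => X /=; rewrite scalerDl. Qed.

HB.instance Definition _ :=
  GRing.Zmodule_isLmodule.Build Cinf operator
    scale_opA scale_op1 scale_opDr scale_opDl.

End Operators.

Section Torsions.
Context {R : realType} {n : nat} {M : smooth_manifold R n}.
Implicit Types (A B : operator M) (X Y : vector_field M) (H : set (operator M)).

Fixpoint torsion (m : nat) A X Y : vector_field M :=
  if m is m'.+1 then
    A (A (torsion m' A X Y)) + torsion m' A (A X) (A Y)
      - A (torsion m' A X (A Y) + torsion m' A (A X) Y)
  else lie_bracket X Y.

Definition generalized_nijenhuis (m : nat) A :=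
  forall X Y, torsion m A X Y = 0.

Definition polarization (m : nat) (A : 'I_(2 * m) -> operator M) X Y :
    vector_field M :=
  \sum_(I : {set 'I_(2 * m)} | I != finset.set0)
    (-1) ^+ (2 * m - #|I|) *: torsion m (\sum_(i in I) A i) X Y.

(* The list (A, ..., A, B, ..., B) of length 2m with [k] final copies of B. *)
Definition repeat_ops (m k : nat) A B (i : 'I_(2 * m)) : operator M :=
  if (i < 2 * m - k)%N then A else B.

Definition haantjes_module (m : nat) H :=
  forall K1 K2, H K1 -> H K2 -> forall f g : smooth_fun M,
  forall X Y, torsion m (f *: K1 + g *: K2) X Y = 0.

Definition haantjes_vector_space (m : nat) H :=
  forall K1 K2, H K1 -> H K2 -> forall a b : R,
  forall X Y, torsion m (smooth_cst M a *: K1 + smooth_cst M b *: K2) X Y = 0.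

Definition real_span A B : set (operator M) :=
  [set K | exists a b : R, K = smooth_cst M a *: A + smooth_cst M b *: B].

Definition module_span A B : set (operator M) :=
  [set K | exists f g : smooth_fun M, K = f *: A + g *: B].

End Torsions.

Arguments polarization {R n M} m A X Y.
Arguments repeat_ops {R n M} m k A B i.

(* Main.v *)
(* The torsion tau^(m) at f A + g B is a homogeneous polynomial of degree 2m in
   (f, g) with coefficients T_0, ..., T_2m independent of f and g.  For real
   constants this is clear, since the Lie bracket is R-bilinear.  For functions
   it needs m >= 2 and AB = BA: the expansion of tau^(1) has tensorial
   coefficients up to terms involving the derivatives of f and g, which the
   next step of the recursion annihilates; from then on everything is tensorial.
   Evaluated at natural numbers, the polynomial turns the polarization at k
   copies of B into (2m - k)! k! T_k, while T_0 and T_2m are the torsions of A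
   and B. *)
Require Import Defs.
From mathcomp Require Import all_boot all_order all_algebra.
From mathcomp Require Import all_classical all_reals all_analysis.
From mathcomp Require Import ring.

Set Implicit Arguments.
Unset Strict Implicit.
Unset Printing Implicit Defensive.

Import GRing.Theory.

Local Open Scope ring_scope.

(** * Signed sums over subsets as counts of surjections *)

Section PolarizationCoefficients.
Variable C : comPzRingType.

(** Expand the product over [i] of [1 + e i], where [e i] is [0] on the image of [f] and [-1] off
    it. A subset [I] contributes its sign exactly when it contains the image, and the product
    vanishes as soon as some [i] is missed. *)
Lemma sum_sign_supset (T : finType) (f : {ffun T -> T}) :
  \sum_(I : {set T}) (-1) ^+ (#|T| - #|I|) * [forall t, f t \in I]%:R
    = [forall i, i \in codom f]%:R :> C.
Proof.
have prod01 (b : pred T) : \prod_(i : T) (b i)%:R = [forall i, b i]%:R :> C.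
  case: forallP => [bT|/forallP/forallPn[i /negbTE bi]].
    by rewrite big1 // => i _; rewrite bT.
  by rewrite (bigD1 i) //= bi mul0r.
transitivity (\prod_(i : T) (1 + (if i \in codom f then 0 else -1)) : C); last first.
  by rewrite -prod01; apply: eq_bigr => i _; case: ifP => _; rewrite ?addr0 ?subrr.
rewrite bigA_distr; apply: eq_bigr => I _.
rewrite (bigID (mem I)) /= big1 ?mul1r => [|i ->//].
case: forallP => [fI|/forallP/forallPn[t tI]].
  rewrite mulr1 (eq_bigr (fun=> -1)) => [|i /negbTE iI].
    rewrite prodr_const -(cardsC I) addKn; congr (_ ^+ _).
    by apply: eq_card => i; rewrite !inE.
  by rewrite iI; case: codomP => // -[t it]; rewrite it fI in iI.
by rewrite mulr0 (bigD1 (f t)) //= (negbTE tI) codom_f mul0r.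
Qed.

(* The powers count maps [t |-> f t] into [I] with [f t < b] exactly when
   [t < a], so by inclusion-exclusion the signed sum counts the surjections
   among them; being bijective, these exist only if [a = b]. *)
Lemma sum_sign_card_exp (n a b : nat) : (a <= n)%N -> (b <= n)%N ->
  exists2 c : nat, (c == 0%N) = (a != b) &
  \sum_(I : {set 'I_n}) (-1) ^+ (n - #|I|) *
     (#|[set i in I | i < b]%N|%:R ^+ a * #|[set i in I | b <= i]%N|%:R ^+ (n - a))
  = c%:R :> C.
Proof.
move=> an bn.
pose ok (f : {ffun 'I_n -> 'I_n}) := [forall t : 'I_n, (t < a)%N == (f t < b)%N].
pose surj (f : {ffun 'I_n -> 'I_n}) := [forall i, i \in codom f].
have card_lt k : (k <= n)%N -> #|[set i : 'I_n | (i < k)%N]| = k.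
  move=> kn; rewrite -[RHS](card_ord k) -[RHS]sum1_card -sum1_card.
  rewrite (big_ord_widen n (fun=> 1%N) kn).
  by apply: eq_bigl => i; rewrite inE.
exists #|[pred f | surj f && ok f]|.
  apply/eqP/idP => [c0|/eqP ab].
    apply/eqP => ab.
    have := card0_eq c0 (finfun id); rewrite !inE => /negP; apply.
    apply/andP; split; first by apply/forallP => i; apply/codomP; exists i; rewrite ffunE.
    by apply/forallP => t; rewrite ffunE ab.
  apply: eq_card0 => f; rewrite !inE; apply/negP => /andP[/forallP fS /forallP fok].
  have finj : injective f.
    suff /image_injP fI : #|codom f| == #|'I_n| by move=> x y; exact: fI.
    by apply/eqP/eq_card => i; rewrite fS.
  apply: ab; rewrite -(card_lt a an) -(card_lt b bn).
  rewrite -(card_imset _ finj); apply: eq_card => i; rewrite inE.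
  have /codomP[t ->] := fS i.
  by rewrite (finset.mem_imset _ _ finj) inE (eqP (fok t)).
transitivity (\sum_(I : {set 'I_n}) \sum_(f | ok f)
    (-1) ^+ (n - #|I|) * [forall t, f t \in I]%:R : C).
  apply: eq_bigr => I _; rewrite -big_distrr /=; congr (_ * _).
  (* Each position [t] independently chooses a value in [I] on its own side of the threshold [b], so
     the product of powers distributes into a sum over maps. *)
  transitivity (\prod_(t < n) \sum_(i : 'I_n)
      ((i \in I) && ((t < a)%N == (i < b)%N))%:R : C).
    rewrite (eq_bigr (fun t : 'I_n => if (t < a)%N
      then #|[set i in I | i < b]%N|%:R else #|[set i in I | b <= i]%N|%:R)); last first.
      move=> t _; case: (t < a)%N; rewrite -sum1_card natr_sum [RHS]big_mkcond /=.
        by apply: eq_bigr => i _; rewrite inE; case: (_ && _).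
      by apply: eq_bigr => i _; rewrite inE [(b <= i)%N]leqNgt; case: (i < b)%N; case: (i \in I).
    rewrite (bigID (fun t : 'I_n => (t < a)%N)) /=; congr (_ * _).
      rewrite (eq_bigr (fun=> #|[set i in I | i < b]%N|%:R)) => [|t ->//].
      rewrite prodr_const; congr (_ ^+ _).
      by rewrite -[in LHS](card_lt a an); apply: eq_card => i; rewrite inE.
    rewrite (eq_bigr (fun=> #|[set i in I | b <= i]%N|%:R)) => [|t /negbTE->//].
    rewrite prodr_const; congr (_ ^+ _).
    rewrite -[in LHS](card_lt a an) -[X in (X - _)%N]card_ord.
    rewrite -(cardsC [set i : 'I_n | (i < a)%N]) addKn.
    by apply: eq_card => i; rewrite !inE.
  rewrite bigA_distr_bigA /= [RHS]big_mkcond /=; apply: eq_bigr => f _.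
  rewrite -natr_prod; case: ifP => [/forallP fok|/negbT/forallPn[t /negbTE tok]].
    case: forallP => [fI|/forallP/forallPn[t /negbTE tI]].
      by rewrite big1 // => t _; rewrite fI fok.
    by rewrite (bigD1 t) //= tI.
  by rewrite (bigD1 t) //= tok andbF.
rewrite exchange_big /= -sum1_card natr_sum.
rewrite [RHS](eq_bigl (fun f => ok f && surj f)) => [|f]; last by rewrite inE andbC.
rewrite big_mkcondr; apply: eq_bigr => f _.
transitivity (\sum_(I : {set 'I_n})
  (-1) ^+ (#|'I_n| - #|I|) * [forall t, f t \in I]%:R : C).
  by rewrite card_ord.
by rewrite sum_sign_supset -/(surj f); case: (surj f).
Qed.

End PolarizationCoefficients.

(** * Homogeneous polynomial families of bilinear maps, and their behaviour under the torsion
    recursion *)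

Section HomogeneousFamilies.
Context {R : realType} {n : nat} {M : smooth_manifold R n}.
Local Notation Cinf := (smooth_fun M).
Local Notation VF := (vector_field M).
Variable S : Cinf -> Prop.

(** The scalars [S] admit two readings: with the real constants this is R-bilinearity, as for the
    Lie bracket; with all smooth functions it is tensoriality. *)
Definition bilinear_over (phi : VF -> VF -> VF) :=
  [/\ forall X X' Y, phi (X + X') Y = phi X Y + phi X' Y,
      forall X Y Y', phi X (Y + Y') = phi X Y + phi X Y',
      forall s X Y, S s -> phi (s *: X) Y = s *: phi X Y &
      forall s X Y, S s -> phi X (s *: Y) = s *: phi X Y].

(* A homogeneous polynomial of degree [N] in [f, g] whose coefficients [T] do
   not depend on [f, g]; [T l] matters only for [l <= N]. *)
Definition hom_sum N (T : nat -> VF -> VF -> VF) (f g : Cinf) X Y : VF :=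
  \sum_(l < N.+1) (f ^+ (N - l) * g ^+ l) *: T l X Y.

Definition homogeneous_over N (Phi : Cinf -> Cinf -> VF -> VF -> VF) :=
  exists2 T : nat -> VF -> VF -> VF, forall l, bilinear_over (T l) &
    forall f g, S f -> S g -> forall X Y, Phi f g X Y = hom_sum N T f g X Y.

Implicit Types (A B C : operator M) (Phi Psi : Cinf -> Cinf -> VF -> VF -> VF).

Lemma comb_opE (f g : Cinf) A B X : (f *: A + g *: B) X = f *: A X + g *: B X.
Proof. by []. Qed.

Lemma opD A X Y : A (X + Y) = A X + A Y.
Proof. exact: linearD. Qed.

Lemma opZ A f X : A (f *: X) = f *: A X.
Proof. exact: linearZ. Qed.

Lemma opN A X : A (- X) = - A X.
Proof. exact: linearN. Qed.

Lemma bilinear_over0 : bilinear_over (fun _ _ => 0).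
Proof. by split=> *; rewrite ?addr0 ?scaler0. Qed.

Lemma bilinear_overD phi psi : bilinear_over phi -> bilinear_over psi ->
  bilinear_over (fun X Y => phi X Y + psi X Y).
Proof.
move=> [a b c d] [a' b' c' d']; split=> *.
- by rewrite a a' addrACA.
- by rewrite b b' addrACA.
- by rewrite c // c' // scalerDr.
- by rewrite d // d' // scalerDr.
Qed.

Lemma bilinear_overZ h phi : bilinear_over phi ->
  bilinear_over (fun X Y => h *: phi X Y).
Proof.
move=> [a b c d]; split=> *.
- by rewrite a scalerDr.
- by rewrite b scalerDr.
- by rewrite c // !scalerA mulrC.
- by rewrite d // !scalerA mulrC.
Qed.

Lemma bilinear_over_sum (I : Type) (r : seq I) (phi : I -> VF -> VF -> VF) :
  (forall i, bilinear_over (phi i)) ->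
  bilinear_over (fun X Y => \sum_(i <- r) phi i X Y).
Proof.
move=> bphi; elim: r => [|i r IH].
  by split=> *; rewrite !big_nil ?addr0 ?scaler0.
have [a b c d] := bilinear_overD (bphi i) IH.
by split=> *; rewrite !big_cons; [exact: a|exact: b|exact: c|exact: d].
Qed.

Lemma homogeneous_over_bilinear N Phi f g : homogeneous_over N Phi ->
  S f -> S g -> bilinear_over (Phi f g).
Proof.
move=> [T bT PhiT] Sf Sg.
have -> : Phi f g = hom_sum N T f g.
  by apply/funext => X; apply/funext => Y; exact: PhiT.
by apply: bilinear_over_sum => l; exact: bilinear_overZ.
Qed.

Lemma eq_homogeneous_over N Phi Psi :
  (forall f g, S f -> S g -> forall X Y, Phi f g X Y = Psi f g X Y) ->
  homogeneous_over N Phi -> homogeneous_over N Psi.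
Proof.
by move=> PP [T bT PhiT]; exists T => // f g Sf Sg X Y; rewrite -PP // PhiT.
Qed.

Lemma homogeneous_overD N Phi Psi :
  homogeneous_over N Phi -> homogeneous_over N Psi ->
  homogeneous_over N (fun f g X Y => Phi f g X Y + Psi f g X Y).
Proof.
move=> [T bT PhiT] [U bU PsiU]; exists (fun l X Y => T l X Y + U l X Y).
  by move=> l; exact: bilinear_overD.
move=> f g Sf Sg X Y; rewrite PhiT // PsiU // /hom_sum -big_split /=.
by apply: eq_bigr => l _; rewrite scalerDr.
Qed.

Lemma homogeneous_overN N Phi :
  homogeneous_over N Phi -> homogeneous_over N (fun f g X Y => - Phi f g X Y).
Proof.
move=> [T bT PhiT]; exists (fun l X Y => -1 *: T l X Y).
  by move=> l; exact: bilinear_overZ.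
move=> f g Sf Sg X Y; rewrite PhiT // /hom_sum -sumrN.
by apply: eq_bigr => l _; rewrite scaleN1r scalerN.
Qed.

Lemma homogeneous_over_mix N Phi Psi :
  homogeneous_over N Phi -> homogeneous_over N Psi ->
  homogeneous_over N.+1 (fun f g X Y => f *: Phi f g X Y + g *: Psi f g X Y).
Proof.
move=> [T bT PhiT] [U bU PsiU].
(* The coefficient at [l] is [T l + U (l - 1)]; beyond degree [N] the values of [T] are arbitrary,
   hence the cut-off. *)
exists (fun l X Y => (if (l <= N)%N then T l X Y else 0)
                     + (if l is l'.+1 then U l' X Y else 0)).
  move=> l; apply: bilinear_overD; first by case: (l <= N)%N; [|exact: bilinear_over0].
  by case: l => [|l]; [exact: bilinear_over0|].
move=> f g Sf Sg X Y; rewrite PhiT // PsiU // /hom_sum.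
under [RHS]eq_bigr do rewrite scalerDr.
rewrite big_split /=; congr (_ + _).
  rewrite [RHS]big_ord_recr /= ltnn scaler0 addr0 scaler_sumr.
  by apply: eq_bigr => l _; rewrite -ltnS ltn_ord scalerA mulrA -exprS subSn // -ltnS.
rewrite [RHS]big_ord_recl /= scaler0 add0r scaler_sumr.
by apply: eq_bigr => l _; rewrite scalerA mulrCA -exprS.
Qed.

Lemma homogeneous_over_comp N Phi A B C : homogeneous_over N Phi ->
  [/\ homogeneous_over N (fun f g X Y => A (Phi f g X Y)),
      homogeneous_over N (fun f g X Y => Phi f g (B X) Y) &
      homogeneous_over N (fun f g X Y => Phi f g X (C Y))].
Proof.
move=> [T bT PhiT]; split.
- exists (fun l X Y => A (T l X Y)); [move=> l|move=> f g Sf Sg X Y].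
    have [a b c d] := bT l.
    by split=> *; rewrite ?a ?b ?c ?d // ?opD ?opZ.
  by rewrite PhiT // /hom_sum linear_sum; apply: eq_bigr => l _; rewrite opZ.
- exists (fun l X Y => T l (B X) Y); last by move=> f g Sf Sg X Y; rewrite PhiT.
  move=> l.
  have [a b c d] := bT l.
  by split=> * /=; [rewrite opD a|rewrite b|rewrite opZ c|rewrite d].
- exists (fun l X Y => T l X (C Y)); last by move=> f g Sf Sg X Y; rewrite PhiT.
  move=> l.
  have [a b c d] := bT l.
  by split=> * /=; [rewrite a|rewrite opD b|rewrite c|rewrite opZ d].
Qed.

(** Each occurrence of [f *: A + g *: B] raises the degree by one. When it sits in an argument,
    [S]-linearity of [Phi f g] moves [f] and [g] out; this is why bilinearity is carried along. *)
Lemma homogeneous_over_comb N Phi A B : homogeneous_over N Phi ->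
  [/\ homogeneous_over N.+1 (fun f g X Y => (f *: A + g *: B) (Phi f g X Y)),
      homogeneous_over N.+1 (fun f g X Y => Phi f g ((f *: A + g *: B) X) Y) &
      homogeneous_over N.+1 (fun f g X Y => Phi f g X ((f *: A + g *: B) Y))].
Proof.
move=> hPhi.
have [hA1 hA2 hA3] := homogeneous_over_comp A A A hPhi.
have [hB1 hB2 hB3] := homogeneous_over_comp B B B hPhi.
split; [move: (homogeneous_over_mix hA1 hB1)|move: (homogeneous_over_mix hA2 hB2)
       |move: (homogeneous_over_mix hA3 hB3)]; apply: eq_homogeneous_over => //.
- move=> f g Sf Sg X Y; have [a _ c _] := homogeneous_over_bilinear hPhi Sf Sg.
  by rewrite comb_opE a !c.
- move=> f g Sf Sg X Y; have [_ b _ d] := homogeneous_over_bilinear hPhi Sf Sg.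
  by rewrite comb_opE b !d.
Qed.

(** The recursion of [torsion], detached from the map it acts on, so that it can be applied
    separately to the tensorial and non-tensorial parts of [tau^(1)]. *)
Definition torsion_step (K : operator M) (phi : VF -> VF -> VF) X Y : VF :=
  K (K (phi X Y)) + phi (K X) (K Y) - K (phi X (K Y) + phi (K X) Y).

Lemma homogeneous_over_step N Phi A B : homogeneous_over N Phi ->
  homogeneous_over N.+2
    (fun f g => torsion_step (f *: A + g *: B) (Phi f g)).
Proof.
move=> hPhi; have [h1 h2 h3] := homogeneous_over_comb A B hPhi.
have [h11 _ _] := homogeneous_over_comb A B h1.
have [_ _ h23] := homogeneous_over_comb A B h2.
have [h4 _ _] := homogeneous_over_comb A B (homogeneous_overD h3 h2).
exact: homogeneous_overD (homogeneous_overD h11 h23) (homogeneous_overN h4).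
Qed.

(** The starting level [k] is left free: the induction begins at level 0 and degree 0 for real
    constants, at level 2 and degree 4 for functions. *)
Lemma homogeneous_over_torsion k N m A B :
  homogeneous_over N (fun f g => torsion k (f *: A + g *: B)) ->
  homogeneous_over (2 * m + N) (fun f g => torsion (m + k) (f *: A + g *: B)).
Proof.
move=> hk; elim: m => [|m IH] //.
by rewrite mulnS; exact: homogeneous_over_step IH.
Qed.

End HomogeneousFamilies.

(** * The start of the recursion: Leibniz rules, real constants, then functions with commuting
    operators *)

Section LieBracket.
Context {R : realType} {n : nat} {M : smooth_manifold R n}.
Local Notation Cinf := (smooth_fun M).
Local Notation VF := (vector_field M).
Implicit Types (A B K : operator M) (X Y : VF) (f g h : Cinf).

Lemma vf_zeroE p h : (0 : VF) p h = 0. Proof. by []. Qed.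
Lemma vf_addE X Y p h : (X + Y) p h = X p h + Y p h. Proof. by []. Qed.
Lemma vf_oppE X p h : (- X) p h = - X p h. Proof. by []. Qed.
Lemma vf_scaleE f X p h : (f *: X) p h = f p * X p h. Proof. by []. Qed.
Lemma sf_mulE f g (p : M) : (f * g) p = f p * g p. Proof. by []. Qed.
Lemma vf_applyE X f p : vf_apply X f p = X p f. Proof. by []. Qed.
Lemma lie_bracketE X Y p h :
  lie_bracket X Y p h = X p (vf_apply Y h) - Y p (vf_apply X h).
Proof. by []. Qed.
Definition vfE := (vf_zeroE, vf_addE, vf_oppE, vf_scaleE, sf_mulE).

Lemma lie_bracketC X Y : lie_bracket X Y = - lie_bracket Y X.
Proof. by apply: vf_eqP => p h /=; rewrite opprB. Qed.

Lemma lie_bracketDr X Y Y' :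
  lie_bracket X (Y + Y') = lie_bracket X Y + lie_bracket X Y'.
Proof.
apply: vf_eqP => p h; have [aX _ _] := vf_tangent X p.
have this : vf_apply (Y + Y') h = vf_apply Y h + vf_apply Y' h by apply: val_inj.
by rewrite vfE !lie_bracketE this aX vfE opprD addrACA.
Qed.

Lemma lie_bracketDl X X' Y :
  lie_bracket (X + X') Y = lie_bracket X Y + lie_bracket X' Y.
Proof. by rewrite lie_bracketC lie_bracketDr opprD -!(lie_bracketC _ Y). Qed.

Lemma lie_bracketZr f X Y :
  lie_bracket X (f *: Y) = f *: lie_bracket X Y + vf_apply X f *: Y.
Proof.
apply: vf_eqP => p h; have [_ _ mX] := vf_tangent X p.
have this : vf_apply (f *: Y) h = f * vf_apply Y h by apply: val_inj.
rewrite !vfE !lie_bracketE this mX !vfE !vf_applyE; ring.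
Qed.

Lemma lie_bracketZl f X Y :
  lie_bracket (f *: X) Y = f *: lie_bracket X Y - vf_apply Y f *: X.
Proof. by rewrite lie_bracketC lie_bracketZr opprD -scalerN -lie_bracketC. Qed.

Definition constant_fun : Cinf -> Prop := fun f => exists r, f = smooth_cst M r.

Lemma vf_apply_cst X r : vf_apply X (smooth_cst M r) = 0.
Proof.
apply: val_inj; apply/funext => p /=; have [_ lX mX] := vf_tangent X p.
have e1 : X p 1 = 0.
  by have := mX 1 1; rewrite mulr1 !mul1r -[LHS]addr0 => /addrI.
by have := lX r 1; rewrite mulr1 e1 mulr0.
Qed.

Lemma homogeneous_over_torsion_cst m A B :
  homogeneous_over constant_fun (2 * m)
    (fun f g => torsion m (f *: A + g *: B)).
Proof.
rewrite -[(2 * m)%N]addn0 -[X in torsion X]addn0.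
apply: homogeneous_over_torsion.
exists (fun=> lie_bracket) => [_|f g _ _ X Y]; last first.
  by rewrite /hom_sum big_ord1 !expr0 mulr1 scale1r.
split=> [X X' Y|X Y Y'|s X Y [r ->]|s X Y [r ->]].
- exact: lie_bracketDl.
- exact: lie_bracketDr.
- by rewrite lie_bracketZl vf_apply_cst scale0r subr0.
- by rewrite lie_bracketZr vf_apply_cst scale0r addr0.
Qed.

(** At [B = A] this is the Nijenhuis torsion of [A]; its symmetrization in [A] and [B] is the polar
    form of that torsion. *)
Definition mixed_torsion A B X Y : VF :=
  A (B (lie_bracket X Y)) + lie_bracket (A X) (B Y)
    - A (lie_bracket X (B Y)) - B (lie_bracket (A X) Y).

(* Without explicit operators, [opD] and its companions would also match
   [-%R] and [*:%R f] through their canonical linear structures. *)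
Ltac expand_fields A B AB :=
  do ?[rewrite !(opZ A) | rewrite !(opZ B) | rewrite !(opD A) | rewrite !(opD B)
     | rewrite !lie_bracketDl | rewrite !lie_bracketDr
     | rewrite !lie_bracketZl | rewrite !lie_bracketZr
     | rewrite !(opN A) | rewrite !(opN B)];
  do ?rewrite AB; apply: vf_eqP => p h;
  do ?[rewrite !vf_addE | rewrite !vf_oppE | rewrite !vf_scaleE
      | rewrite !vf_applyE | rewrite !sf_mulE].

(** The derivatives of [s] cancel in pairs. In the first argument one pair is [(Y s) A (B X)]
    against [(Y s) B (A X)], where commutation enters. *)
Lemma mixed_torsion_bilinear A B : (forall X, A (B X) = B (A X)) ->
  bilinear_over (fun=> True) (mixed_torsion A B).
Proof.
move=> AB; split=> [X X' Y|X Y Y'|s X Y _|s X Y _]; rewrite /mixed_torsion.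
- expand_fields A B AB; ring.
- expand_fields A B AB; ring.
- expand_fields A B AB; ring.
- expand_fields A B AB; ring.
Qed.

(* The non-tensorial part of [tau^(1)] at [K = f A + g B]: the terms in which
   [K X] or [X] differentiates [f] or [g].  As [A] and [B] commute, it
   intertwines [K] acting on [Y] with [K] acting on the value, so that the next
   recursion step kills it. *)
Definition half_defect (K A B : operator M) f g X Y : VF :=
  vf_apply (K X) f *: A Y + vf_apply (K X) g *: B Y
    - K (vf_apply X f *: A Y + vf_apply X g *: B Y).

Definition torsion_defect A B f g X Y : VF :=
  half_defect (f *: A + g *: B) A B f g X Y
    - half_defect (f *: A + g *: B) A B f g Y X.

Lemma torsion1_comb A B f g X Y : (forall X, A (B X) = B (A X)) ->
  torsion 1 (f *: A + g *: B) X Y =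
  ((f ^+ 2) *: mixed_torsion A A X Y
   + ((f * g) *: (mixed_torsion A B X Y + mixed_torsion B A X Y)
   + (g ^+ 2) *: mixed_torsion B B X Y)) + torsion_defect A B f g X Y.
Proof.
move=> AB; rewrite /torsion /mixed_torsion /torsion_defect /half_defect !comb_opE.
expand_fields A B AB.
ring.
Qed.

Lemma half_defect_comm K A B f g X Y :
  (forall X, A (K X) = K (A X)) -> (forall X, B (K X) = K (B X)) ->
  half_defect K A B f g X (K Y) = K (half_defect K A B f g X Y).
Proof.
by move=> AK BK; rewrite /half_defect !AK !BK !(opD K) !(opN K) !(opD K) !(opZ K).
Qed.

(** With [e] the half defect, the rule [e X (K Y) = K (e X Y)] reduces every term of the step to
    [K (K (e X Y))], [K (e (K X) Y)] or one of these with [X] and [Y] swapped, and they cancel. *)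
Lemma torsion_step_defect A B f g X Y : (forall X, A (B X) = B (A X)) ->
  torsion_step (f *: A + g *: B) (torsion_defect A B f g) X Y = 0.
Proof.
move=> AB; rewrite /torsion_step /torsion_defect.
have AK Z : A ((f *: A + g *: B) Z) = (f *: A + g *: B) (A Z).
  by rewrite !comb_opE (opD A) !(opZ A) AB.
have BK Z : B ((f *: A + g *: B) Z) = (f *: A + g *: B) (B Z).
  by rewrite !comb_opE (opD B) !(opZ B) AB.
have := half_defect_comm f g _ _ AK BK.
move: (f *: A + g *: B) => K; move: (half_defect K A B f g) => e eK.
rewrite !eK !(opD K) !(opN K).
by apply: vf_eqP => p h; rewrite !vfE; ring.
Qed.

Lemma torsion_stepD K phi psi X Y :
  torsion_step K (fun X Y => phi X Y + psi X Y) X Y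
    = torsion_step K phi X Y + torsion_step K psi X Y.
Proof.
rewrite /torsion_step !opD; apply: vf_eqP => p h; rewrite !vfE; ring.
Qed.

Lemma homogeneous_over_torsion_commuting m A B :
  (2 <= m)%N -> (forall X, A (B X) = B (A X)) ->
  homogeneous_over (fun=> True) (2 * m)
    (fun f g => torsion m (f *: A + g *: B)).
Proof.
move=> m2 AB; rewrite -(subnK m2) mulnDr.
apply: homogeneous_over_torsion.
have h1 : homogeneous_over (fun=> True) 2 (fun f g X Y =>
   (f ^+ 2) *: mixed_torsion A A X Y
   + ((f * g) *: (mixed_torsion A B X Y + mixed_torsion B A X Y)
   + (g ^+ 2) *: mixed_torsion B B X Y)).
  exists (fun l => match l with
    | 0 => mixed_torsion A A
    | 1 => fun X Y => mixed_torsion A B X Y + mixed_torsion B A X Y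
    | _ => mixed_torsion B B end) => [[|[|l]]|f g _ _ X Y].
  - exact: mixed_torsion_bilinear.
  - by apply: bilinear_overD; exact: mixed_torsion_bilinear.
  - exact: mixed_torsion_bilinear.
  rewrite /hom_sum !big_ord_recl big_ord0 addr0 /= /bump /=.
  by rewrite !expr0 !expr1 mulr1 mul1r.
apply: eq_homogeneous_over (homogeneous_over_step A B h1) => f g _ _ X Y.
(* Adding the vanishing step of the defect completes the tensorial part to [tau^(1)], whose step is
   [tau^(2)]. *)
rewrite -[LHS]addr0 -(torsion_step_defect f g X Y AB) -torsion_stepD.
by rewrite /torsion_step -!torsion1_comb.
Qed.

End LieBracket.

(** * Recovering the coefficients from the polarizations *)

Section Polarization.
Context {R : realType} {n : nat} {M : smooth_manifold R n}.
Local Notation Cinf := (smooth_fun M).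
Local Notation VF := (vector_field M).
Implicit Types (A B : operator M) (X Y : VF) (f g : Cinf).

Lemma smooth_cst1 : smooth_cst M 1 = 1.
Proof. exact: val_inj. Qed.

Lemma smooth_cstD r s : smooth_cst M (r + s) = smooth_cst M r + smooth_cst M s.
Proof. exact: val_inj. Qed.

Lemma smooth_cstM r s : smooth_cst M (r * s) = smooth_cst M r * smooth_cst M s.
Proof. exact: val_inj. Qed.

Lemma smooth_cst_nat k : smooth_cst M k%:R = k%:R.
Proof.
elim: k => [|k IH]; first exact: val_inj.
by rewrite -!natr1 smooth_cstD IH smooth_cst1.
Qed.

Lemma scale_nat_vf_eq0 k X : k != 0%N -> (k%:R : Cinf) *: X = 0 -> X = 0.
Proof.
move=> k0 kX; rewrite -[X]scale1r -smooth_cst1.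
have -> : 1 = k%:R^-1 * k%:R :> R by rewrite mulVf // Num.Theory.pnatr_eq0.
by rewrite smooth_cstM smooth_cst_nat -scalerA kX scaler0.
Qed.

Lemma sum_repeat_ops m k A B (I : {set 'I_(2 * m)}) :
  \sum_(i in I) repeat_ops m k A B i =
  (#|[set i in I | i < 2 * m - k]%N|%:R : Cinf) *: A
    + (#|[set i in I | 2 * m - k <= i]%N|%:R : Cinf) *: B.
Proof.
rewrite (bigID (fun i : 'I__ => (i < 2 * m - k)%N)) /= !scaler_nat -!sumr_const.
congr (_ + _).
  rewrite [RHS](eq_bigl (fun i : 'I__ => (i \in I) && (i < 2 * m - k)%N)).
    by apply: eq_bigr => i /andP[_ ik]; rewrite /repeat_ops ik.
  by move=> i; rewrite inE.
rewrite [RHS](eq_bigl (fun i : 'I__ => (i \in I) && ~~ (i < 2 * m - k)%N)).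
  by apply: eq_bigr => i /andP[_ /negbTE ik]; rewrite /repeat_ops ik.
by move=> i; rewrite inE -leqNgt.
Qed.

Lemma polarization_coef m k A B (T : nat -> VF -> VF -> VF) :
  (1 <= m)%N -> (k <= 2 * m)%N ->
  (forall (i j : nat) X Y, torsion m ((i%:R : Cinf) *: A + (j%:R : Cinf) *: B) X Y
     = hom_sum (2 * m) T i%:R j%:R X Y) ->
  exists2 c : nat, c != 0%N &
    forall X Y, polarization m (repeat_ops m k A B) X Y = (c%:R : Cinf) *: T k X Y.
Proof.
move=> m1 km TE.
(* The signed sum of the monomials with exponents [2m - l] and [l] is nonzero exactly for [l = k]:
   the surjection count with [a = 2m - l] and [b = 2m - k]. *)
have coefP (l : nat) : (l <= 2 * m)%N -> exists c : nat, (c == 0%N) = (l != k) /\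
    \sum_(I : {set 'I_(2 * m)}) (-1) ^+ (2 * m - #|I|) *
      (#|[set i in I | i < 2 * m - k]%N|%:R ^+ (2 * m - l)
       * #|[set i in I | 2 * m - k <= i]%N|%:R ^+ l) = c%:R :> Cinf.
  move=> lm.
  have [c c0 cE] := sum_sign_card_exp Cinf (leq_subr l (2 * m)) (leq_subr k (2 * m)).
  exists c; split; last by rewrite -cE subKn.
  by rewrite c0; congr (~~ _); apply/eqP/eqP => [e|->//]; rewrite -(subKn lm) e subKn.
have [c [c0 cE]] := coefP k km; exists c; first by rewrite c0 eqxx.
move=> X Y.
transitivity (\sum_(I : {set 'I_(2 * m)}) ((-1) ^+ (2 * m - #|I|) : Cinf) *:
    hom_sum (2 * m) T #|[set i in I | i < 2 * m - k]%N|%:R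
                      #|[set i in I | 2 * m - k <= i]%N|%:R X Y).
  (* The empty set, absent from [polarization], may be added: it contributes the polynomial at
     [(0, 0)], which vanishes because its degree [2m] is positive. *)
  rewrite [RHS](bigD1 finset.set0) //= [X in _ = X + _](_ : _ = 0) ?add0r.
    by apply: eq_bigr => I _; rewrite sum_repeat_ops TE.
  rewrite /hom_sum big1 ?scaler0 // => l _.
  have card0 (P : pred 'I_(2 * m)) : #|[set i in finset.set0 | P i]| = 0%N.
    by apply: eq_card0 => i; rewrite !inE.
  rewrite (card0 (fun i => i < _)%N) (card0 (fun i => _ <= i)%N) -exprD.
  rewrite subnK ?leq_ord // expr0n muln_eq0 /= -leqn0.
  rewrite leqNgt m1 scale0r //.
rewrite /hom_sum; under eq_bigr do rewrite scaler_sumr.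
rewrite exchange_big /=.
under eq_bigr => l _.
  under eq_bigr do rewrite scalerA.
  rewrite -scaler_suml; over.
have kS : (k < (2 * m).+1)%N by [].
rewrite (bigD1 (Ordinal kS)) //= cE big1 ?addr0 // => l lk.
have [d [d0 ->]] := coefP l (leq_ord l).
by move: d0; rewrite -(inj_eq val_inj) /= in lk; rewrite lk => /eqP ->; rewrite scale0r.
Qed.

(** Serves both equivalences. Forward, every summand of a polarization is a torsion at natural
    coefficients, which [S] contains. Backward, the polarizations kill the inner coefficients [T k],
    and the torsions of [A] and [B] kill the two outer ones. *)
Lemma torsion_comb_eq0_iff (S : Cinf -> Prop) m A B :
  (1 <= m)%N -> (forall i : nat, S i%:R) ->
  homogeneous_over S (2 * m) (fun f g => torsion m (f *: A + g *: B)) ->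
  generalized_nijenhuis m A -> generalized_nijenhuis m B ->
  (forall f g, S f -> S g -> forall X Y, torsion m (f *: A + g *: B) X Y = 0) <->
  (forall k : nat, (1 <= k <= 2 * m - 1)%N ->
     forall X Y, polarization m (repeat_ops m k A B) X Y = 0).
Proof.
move=> m1 SN [T bT TE] nA nB; split=> [tor0 k _ X Y|pol0 f g Sf Sg X Y].
  by apply: big1 => I _; rewrite sum_repeat_ops tor0 ?scaler0.
have T0 : T 0%N X Y = 0.
  have := TE 1 0 (SN 1%N) (SN 0%N) X Y; rewrite scale1r scale0r addr0 nA.
  rewrite /hom_sum big_ord_recl big1 /= ?addr0 => [|l _].
    by rewrite expr1n expr0 mulr1 scale1r.
  by rewrite exprS mul0r mulr0 scale0r.
have T2m : T (2 * m)%N X Y = 0.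
  have := TE 0 1 (SN 0%N) (SN 1%N) X Y; rewrite scale1r scale0r add0r nB.
  rewrite /hom_sum big_ord_recr big1 /= ?add0r => [|l _].
    by rewrite subnn expr1n expr0 mulr1 scale1r.
  by rewrite expr0n subn_eq0 leqNgt ltn_ord mul0r scale0r.
rewrite TE // /hom_sum big1 // => -[k /= km] _.
case: (posnP k) => [->|k0]; first by rewrite T0 scaler0.
case: (eqVneq k (2 * m)%N) => [->|k2m]; first by rewrite T2m scaler0.
have [c c0 cE] := polarization_coef m1 km (fun i j => TE _ _ (SN i) (SN j)).
rewrite (scale_nat_vf_eq0 c0 (X := T k X Y)) ?scaler0 // -cE pol0 // k0 /=.
by rewrite -ltnS subn1 prednK ?muln_gt0 // ltn_neqAle k2m -ltnS.
Qed.

(** Both spans are closed under combinations, so the Haantjes condition on a span reduces to the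
    torsions of single combinations of [A] and [B]. *)
Lemma comb_comb f g (f1 g1 f2 g2 : Cinf) A B :
  f *: (f1 *: A + g1 *: B) + g *: (f2 *: A + g2 *: B)
  = (f * f1 + g * f2) *: A + (f * g1 + g * g2) *: B.
Proof. by rewrite !scalerDr !scalerA !scalerDl addrACA. Qed.

End Polarization.

Theorem theorem3p12 (R : realType) (n : nat) (M : smooth_manifold R n)
    (m : nat) (A B : operator M) :
  (1 <= m)%N ->
  generalized_nijenhuis m A ->
  generalized_nijenhuis m B ->
  (haantjes_vector_space m (real_span A B) <->
     (forall k : nat, (1 <= k <= 2 * m - 1)%N ->
        forall X Y : vector_field M,
          polarization m (repeat_ops m k A B) X Y = 0)) /\
  ((2 <= m)%N ->
   (forall X : vector_field M, A (B X) = B (A X)) ->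
   (haantjes_module m (module_span A B) <->
     (forall k : nat, (1 <= k <= 2 * m - 1)%N ->
        forall X Y : vector_field M,
          polarization m (repeat_ops m k A B) X Y = 0))).
Proof.
move=> m1 nA nB.
have spanA : A = 1 *: A + 0 *: B by rewrite scale1r scale0r addr0.
have spanB : B = 0 *: A + 1 *: B by rewrite scale1r scale0r add0r.
have c0 : smooth_cst M 0 = 0 by exact: (smooth_cst_nat 0).
split=> [|m2 AB].
- have cN i : constant_fun (i%:R : smooth_fun M).
    by exists i%:R; rewrite smooth_cst_nat.
  rewrite -(torsion_comb_eq0_iff m1 cN (homogeneous_over_torsion_cst m A B)) //.
  split=> [H _ _ [a ->] [b ->]|H K1 K2 [a1 [b1 ->]] [a2 [b2 ->]] a b].
    by apply: H; [exists 1, 0|exists 0, 1]; rewrite smooth_cst1 c0.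
  rewrite comb_comb -!smooth_cstM -!smooth_cstD.
  by apply: H; [exists (a * a1 + b * a2)|exists (a * b1 + b * b2)].
- rewrite -(torsion_comb_eq0_iff m1 (fun=> I)
    (homogeneous_over_torsion_commuting m2 AB)) //.
  split=> [H f g _ _|H K1 K2 [f1 [g1 ->]] [f2 [g2 ->]] f g].
    by apply: H; [exists 1, 0|exists 0, 1].
  by rewrite comb_comb; apply: H.
Qed.
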